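(* Let $Q$ be an irreducible quiver such that each cycle in $Q$ is an oriented cycle. Then $Q$ is a $\mathcal{Q}^N$ quiver (for some $N\ge1$).
   Context: Quivers are finite connected directed graphs without loops or 2-cycles. A quiver is irreducible if each of its arrows lies in some oriented cycle. A cycle in $Q$ means a cycle of its underlying undirected graph (multigraph); it is oriented if its arrows form a directed cycle. $\mathcal{Q}^N$ quivers. For $N\ge1$, a quiver $Q^N$ is a finite connected quiver with vertex set $\{v^i_\ell\mid 1\le i\le N,\ 1\le \ell\le k_i\}$ (with $k_i\ge1$) whose arrows are exactly: (1) the vertical arrows $v^i_1\leftarrow v^i_2\leftarrow\cdots\leftarrow v^i_{k_i}$ for $i=1,\dots,N$ (the $i$-th vertical chain); (2) oblique arrows: for two distinct chains, the arrows between them (if there are any) form exactly one path $v^i_{a_1}\to v^j_{b_1}\to v^i_{a_2}\to v^j_{b_2}\to v^i_{a_3}\to\cdots$ (starting in one of the two chains, called chain $i$, and ending in either), with $1\le a_1<a_2<\cdots\le k_i$ and $1\le b_1<b_2<\cdots\le k_j$; (3) if $3\le m\le N$, $i_1,\dots,i_m$ are pairwise distinct and there is an arrow (in either direction) between the chains $i_r$ and $i_{r+1}$ for each $r=1,\dots,m-1$, then there is no arrow between the chains $i_1$ and $i_m$. A quiver is called a $\mathcal{Q}^N$ quiver if its vertices can be labelled so that it has this form for some $N\ge 1$. *)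

(* Defs.v *)
From HB Require Import structures.
From mathcomp Require Import all_boot.
Set Implicit Arguments.
Unset Strict Implicit.
Unset Printing Implicit Defensive.

(* Parallel arrows are allowed, hence a type of arrows rather than a relation. *)
Record quiver := Quiver {
  vertex : finType;
  arrow : finType;
  src : arrow -> vertex;
  tgt : arrow -> vertex;
  quiver_nonempty : 0 < #|vertex|;
  quiver_connected : forall x y : vertex,
    connect [rel u w | [exists e, ((src e == u) && (tgt e == w))
                               || ((src e == w) && (tgt e == u))]] x y;
  quiver_no_loop : forall e, src e <> tgt e;
  quiver_no_2cycle : forall e f, ~ (src f = tgt e /\ tgt f = src e)
}.

Section Cycles.
Variable Q : quiver.

(* A step (e, b) traverses the arrow e along its orientation if b = true, and
   against it if b = false. *)
Definition step := (arrow Q * bool)%type.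
Definition step_start (s : step) := if s.2 then src s.1 else tgt s.1.
Definition step_end (s : step) := if s.2 then tgt s.1 else src s.1.

(* Cycles of the underlying undirected multigraph: no repeated vertex and no
   repeated edge, the latter so that going back and forth along one arrow is
   not a cycle; two parallel arrows do form a cycle of length 2. *)
Definition is_cycle (c : seq step) : bool :=
  [&& 0 < size c,
      cycle (fun s t => step_end s == step_start t) c,
      uniq [seq step_start s | s <- c] &
      uniq [seq s.1 | s <- c]].

Definition oriented (c : seq step) : bool :=
  all (fun s => s.2) c || all (fun s => ~~ s.2) c.

Definition irreducible : Prop :=
  forall e : arrow Q,
    exists c, [/\ is_cycle c, oriented c & e \in [seq s.1 | s <- c]].

Definition narrows (x y : vertex Q) : nat :=
  #|[set e : arrow Q | (src e == x) && (tgt e == y)]|.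

End Cycles.

Section QN.
Variables (Q : quiver) (N : nat) (k : 'I_N -> nat).
(* v i l is the vertex v^(i+1)_(l+1): both indices are counted from 0. *)
Variable v : forall i : 'I_N, 'I_(k i) -> vertex Q.

Definition labelling : Prop :=
  bijective (fun x : {i : 'I_N & 'I_(k i)} => v (tagged x)).

Definition vertical_arrows : Prop :=
  forall (i : 'I_N) (l l' : 'I_(k i)),
    narrows (v l) (v l') = (l == l'.+1 :> nat).

Definition chain_adj (i j : 'I_N) : bool :=
  [exists l : 'I_(k i), exists l' : 'I_(k j),
     (0 < narrows (v l) (v l')) || (0 < narrows (v l') (v l))].

(* The arrows between the chains i and j form the path
     v^i_(a_1) -> v^j_(b_1) -> v^i_(a_2) -> v^j_(b_2) -> ...
   whose arrows from i to j are the pairs (a_r, b_r), and whose arrows from j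
   to i are the pairs (b_r, a_(r+1)). *)
Definition oblique_path (i j : 'I_N) : Prop :=
  exists (a : seq 'I_(k i)) (b : seq 'I_(k j)),
    [/\ sorted (fun x y : 'I_(k i) => x < y) a,
        sorted (fun x y : 'I_(k j) => x < y) b,
        0 < size b,
        size a = size b \/ size a = (size b).+1 &
        forall (l : 'I_(k i)) (l' : 'I_(k j)),
          narrows (v l) (v l') = ((l, l') \in zip a b) /\
          narrows (v l') (v l) = ((l', l) \in zip b (behead a))].

Definition oblique_arrows : Prop :=
  forall i j : 'I_N, i != j -> chain_adj i j ->
    oblique_path i j \/ oblique_path j i.

Definition no_chain_cycle : Prop :=
  forall (i1 : 'I_N) (s : seq 'I_N),
    3 <= size (i1 :: s) <= N -> uniq (i1 :: s) -> path chain_adj i1 s ->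
    ~~ chain_adj i1 (last i1 s).

End QN.

Definition QN_quiver (N : nat) (Q : quiver) : Prop :=
  exists (k : 'I_N -> nat) (v : forall i : 'I_N, 'I_(k i) -> vertex Q),
    (forall i, 1 <= k i) /\
    [/\ labelling v, vertical_arrows v, oblique_arrows v & no_chain_cycle v].

(* Main.v *)
Require Import Defs.
From mathcomp Require Import all_boot.
Set Implicit Arguments.
Unset Strict Implicit.
Unset Printing Implicit Defensive.

(** The quiver is a cactus of oriented cycles. Two directed paths with the same
    ends and otherwise disjoint would bound a cycle that is not oriented
    ([no_theta]), while irreducibility and connectedness make the quiver
    strongly connected ([irreducible_connect]). Hence a strongly connected set
    of vertices S that is not everything can be enlarged by an ear: a directed
    path leaves S and comes back for the first time, and it must come back to
    the vertex x that it left, because otherwise a directed path inside S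
    between the two ends would give two parallel paths ([ears_extend]). The new
    vertices together with x form an oriented cycle, and there are no other
    arrows between them, or between them and S: such an arrow would be parallel
    to a longer directed path, since S and the cycle are strongly connected
    ([ear_next]).

    Starting from a single vertex and adding ears until all the vertices are
    reached ([ears_cover]), every ear, without its attaching vertex x, is taken
    as a vertical chain. The arrows between an ear and older chains are the two
    arrows of its cycle at x, so that each chain is adjacent to exactly one
    older chain, apart from the initial vertex, and the oblique arrows form the
    path that enters x from the bottom of the ear and leaves x to its top
    ([chain_attach]). The adjacency graph of the chains is therefore a tree: in
    a cycle of chains, the newest one would have two distinct older neighbours
    ([chain_forest]). *)

(** * Cycles and paths of relations *)

(** Reading off the two ends of each step turns the condition that consecutive
    steps match into an equation between sequences of vertices. *)
Lemma cycle_mapE (T : Type) (U : eqType) (f g : T -> U) (c : seq T) :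
  cycle (fun s t => f s == g t) c = (map f c == rot 1 (map g c)).
Proof.
case: c => [|s c] //=; rewrite rot1_cons.
have pathE t w : path (fun s t => f s == g t) t w
                 = (map f (belast t w) == map g w).
  by elim: w t => //= y w IH t; rewrite eqseq_cons IH.
by rewrite pathE belast_rcons map_rcons.
Qed.

Lemma path_exit (T : eqType) (e : rel T) (A : {pred T}) x p :
  path e x p -> x \in A -> last x p \notin A ->
  exists a b, [/\ a \in A, b \notin A & e a b].
Proof.
elim: p x => [|y p IH] x /=; first by move=> _ ->.
case/andP=> exy yp Ax lpA; have [Ay|nAy] := boolP (y \in A).
  exact: IH yp Ay lpA.
by exists x, y.
Qed.

(** * Directed paths in a quiver *)

Section Paths.
Variable Q : quiver.
Implicit Types (u w x y : vertex Q) (p q d : seq (vertex Q)).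
Implicit Types (es fs : seq (arrow Q)) (cs : seq (seq (vertex Q))).

(** The relation goes against the arrows because the vertices of a vertical
    chain are numbered against its arrows: a chain read in increasing order is
    then a path of [from]. *)
Definition from : rel (vertex Q) :=
  [rel u w | [exists e : arrow Q, (src e == w) && (tgt e == u)]].

Lemma fromP u w :
  reflect (exists e : arrow Q, src e = w /\ tgt e = u) (from u w).
Proof.
apply: (iffP existsP) => -[e]; first by case/andP=> /eqP ? /eqP ?; exists e.
by case=> <- <-; exists e; rewrite !eqxx.
Qed.

Lemma from_irr u : from u u = false.
Proof. by apply/fromP => -[e [<-]] /esym; apply: quiver_no_loop. Qed.

Lemma from_asym u w : from u w -> from w u = false.
Proof.
move=> /fromP[e [<- <-]]; apply/fromP => -[f [fe ef]].
exact: (@quiver_no_2cycle Q e f).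
Qed.

Lemma lift_path u p : path from u p ->
  exists es : seq (arrow Q),
    map (@tgt Q) es = belast u p /\ map (@src Q) es = p.
Proof.
elim: p u => [|w p IH] u /=; first by exists [::].
by case/andP=> /fromP[e [<- <-]] /IH[es [tes ses]]; exists (e :: es); split;
  rewrite /= ?tes ?ses.
Qed.

(** An arrow lies on an oriented cycle, the rest of which leads back from its
    target to its source; the cycle is a cycle of [from] if its steps go against
    the arrows, and of the converse relation otherwise. *)
Lemma irreducible_connect : irreducible Q -> forall u w, connect from u w.
Proof.
move=> irr u w; have := quiver_connected u w.
apply: connect_sub => {w}{}u w /existsP[e he].
have back : connect from (tgt e) (src e).
  by apply: connect1; apply/fromP; exists e.
have forth : connect from (src e) (tgt e).
  have [c [/and4P[_ cyc _ _] orc /mapP[s sc es]]] := irr e.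
  move: cyc; rewrite cycle_mapE => /eqP cycE.
  have ends t : t \in c ->
    step_start t \in map (@step_start Q) c /\
    step_end t \in map (@step_start Q) c.
    move=> tc; split; first exact: map_f.
    by rewrite -(mem_rot 1) -cycE map_f.
  have [st en] := ends s sc.
  have sne : (src e \in map (@step_start Q) c) &&
             (tgt e \in map (@step_start Q) c).
    rewrite es; move: st en; rewrite /step_start /step_end.
    by case: (s.2) => -> ->.
  case/andP: sne => srcC tgtC.
  have [fwd|bwd] := orP orc.
    have cycr : cycle [rel x y | from y x] (map (@step_start Q) c).
      rewrite cycle_map; move/eqP: cycE; rewrite -cycle_mapE.
      apply: (sub_in_cycle _ fwd) => a b; rewrite /in_mem /= => ha hb /eqP.
      rewrite /relpre /= /step_end /step_start ha hb => E.
      by apply/fromP; exists a.1.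
    by have := connect_cycle cycr tgtC srcC; rewrite connect_rev.
  have cycr : cycle from (map (@step_start Q) c).
    rewrite cycle_map; move/eqP: cycE; rewrite -cycle_mapE.
    apply: (sub_in_cycle _ bwd) => a b; rewrite /in_mem /=.
    move=> /negbTE ha /negbTE hb /eqP.
    rewrite /relpre /= /step_end /step_start ha hb => E.
    by apply/fromP; exists a.1.
  exact: (connect_cycle cycr).
by case/orP: he => /andP[/eqP <- /eqP <-].
Qed.

Hypothesis cycQ : forall c : seq (step Q), is_cycle c -> oriented c.

(** Going along [es] and back along [fs] would be a cycle, with steps in both
    orientations. Working with arrows instead of vertices covers the case of two
    parallel arrows ([p] and [q] empty). *)
Lemma parallel_walks u w p q es fs :
  map (@tgt Q) es = u :: p -> map (@src Q) es = rcons p w ->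
  map (@tgt Q) fs = u :: q -> map (@src Q) fs = rcons q w ->
  uniq (u :: w :: p ++ q) -> has (mem es) fs.
Proof.
move=> tes ses tfs sfs U; apply/negPn/negP => dis.
set c := [seq (e, false) | e <- es] ++ [seq (e, true) | e <- rev fs].
have startE : map (@step_start Q) c = u :: p ++ w :: rev q.
  rewrite map_cat -!map_comp -[LHS]/(map (@tgt Q) es ++ map (@src Q) (rev fs)).
  by rewrite map_rev tes sfs rev_rcons.
have endE : map (@step_end Q) c = rcons p w ++ rcons (rev q) u.
  rewrite map_cat -!map_comp -[LHS]/(map (@src Q) es ++ map (@tgt Q) (rev fs)).
  by rewrite map_rev tfs ses rev_cons.
have arrE : map fst c = es ++ rev fs.
  by rewrite map_cat -!map_comp !map_id.
have [/(@map_uniq _ _ (@tgt Q)) ue /(@map_uniq _ _ (@tgt Q)) uf] :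
    uniq (map (@tgt Q) es) /\ uniq (map (@tgt Q) fs).
  move: U; rewrite tes tfs /= inE negb_or mem_cat negb_or cat_uniq.
  by case/and3P=> /and3P[_ -> ->] _ /and3P[-> _ ->].
have cyc : is_cycle c.
  apply/and4P; split.
  - by rewrite size_cat size_map -(size_map (@tgt Q)) tes.
  - by rewrite cycle_mapE startE endE rot1_cons rcons_cat /= cat_rcons.
  - have -> : [seq step_start s | s <- c] = u :: p ++ w :: rev q by [].
    rewrite (@perm_uniq _ _ (u :: w :: p ++ q)) //.
    rewrite perm_cons -[w :: rev q]cat1s perm_catCA /= perm_cons.
    by rewrite perm_cat2l perm_rev.
  - rewrite arrE cat_uniq ue rev_uniq uf andbT /= has_rev.
    exact: dis.
have := cycQ cyc; rewrite /oriented !all_cat !all_map.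
case: (es) tes => // e es' _; case/lastP: (fs) tfs => // fs' f _.
by rewrite rev_rcons /= andbF.
Qed.

(** The only arrow that two such paths can share goes directly from one end to
    the other, in which case each of them is reduced to this arrow. *)
Lemma no_theta u w p q :
  path from u (rcons p w) -> path from u (rcons q w) ->
  uniq (u :: w :: p ++ q) -> p ++ q = [::].
Proof.
move=> /lift_path[es [tes ses]] /lift_path[fs [tfs sfs]] U.
move: tes tfs; rewrite !belast_rcons => tes tfs.
have /hasP[e ef /= ee] := parallel_walks tes ses tfs sfs U.
have: uniq (u :: w :: p ++ q) := U.
rewrite /= inE negb_or !mem_cat !negb_or cat_uniq.
case/and3P=> /and3P[uw up uq] /andP[wp wq] /and3P[Up /hasPn pq Uq].
have eu : tgt e = u.
  have := map_f (@tgt Q) ee; rewrite tes inE => /orP[/eqP //|tp].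
  have := map_f (@tgt Q) ef; rewrite tfs inE => /orP[/eqP //|/pq/negP[]//].
have ew : src e = w.
  have := map_f (@src Q) ee; rewrite ses mem_rcons inE => /orP[/eqP //|tp].
  have := map_f (@src Q) ef; rewrite sfs mem_rcons inE.
  by case/orP=> [/eqP //|/pq/negP[]].
have short z (zs : seq (arrow Q)) : map (@tgt Q) zs = u :: z ->
  map (@src Q) zs = rcons z w -> u \notin z -> w \notin z ->
  e \in zs -> z = [::].
  case: zs => // g zs [] _ tz sz uz wz; rewrite inE => /orP[/eqP ge|gzs].
    case: z sz wz {tz uz} => // z0 z [+ _].
    by rewrite -ge ew => ->; rewrite inE eqxx.
  by case/negP: uz; rewrite -eu -tz map_f.
by rewrite (short p es) // (short q fs).
Qed.

Lemma from_path_short u w p :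
  from u w -> path from u (rcons p w) -> uniq (u :: rcons p w) -> p = [::].
Proof.
move=> uw pp U; rewrite -[p]cats0; apply: (no_theta pp (q := [::])) => /=.
  by rewrite uw.
by move: U; rewrite cats0 /= mem_rcons rcons_uniq.
Qed.

Lemma narrowsE u w : narrows u w = from w u.
Proof.
rewrite /narrows; case: fromP => [[e [se te]]|no].
  apply/eqP/cards1P; exists e; apply/setP => f; rewrite !inE.
  apply/andP/eqP => [[/eqP sf /eqP tf]|->]; last by rewrite se te !eqxx.
  apply/eqP/negPn/negP => fe.
  have := @parallel_walks w u [::] [::] [:: e] [:: f].
  rewrite /= se te sf tf !inE orbF (negPf fe).
  have wu : w != u.
    by apply/eqP => wu; apply: (@quiver_no_loop Q e); rewrite se te.
  by rewrite wu => /(_ erefl erefl erefl erefl isT).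
apply/eqP; rewrite cards_eq0; apply/eqP/setP => e; rewrite !inE.
by apply/negP => /andP[/eqP se /eqP te]; apply: no; exists e.
Qed.

(** * Ear decompositions *)

(** The chains that arise from gluing oriented cycles, the newest first: a cycle
    is glued along one vertex [x] of an older chain, and its other vertices are
    the new chain [d]. Listing the newest first makes the vertices older than a
    chain those of the tail of the list. *)
Inductive ears : seq (seq (vertex Q)) -> Prop :=
| ears_root x : ears [:: [:: x]]
| ears_glue d cs x : ears cs -> x \in flatten cs -> cycle from (x :: d) ->
    uniq (d ++ flatten cs) -> ears (d :: cs).

Lemma ears_uniq cs : ears cs -> uniq (flatten cs).
Proof. by case. Qed.

Lemma ears_drop cs i : ears cs -> i < size cs -> ears (drop i cs).
Proof.
move=> H; elim: H i => [x|d {}cs x H IH xcs cyc U] [|i] //=.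
- by move=> _; apply: ears_root.
- by move=> _; apply: ears_glue cyc U.
- exact: IH.
Qed.

(** The directed paths have to stay within the chains, in order to be disjoint
    from the ears added later. *)
Lemma ears_connected cs : ears cs ->
  {in flatten cs &, forall a b, exists p,
    [/\ path from a p, last a p = b, uniq (a :: p) & {subset p <= flatten cs}]}.
Proof.
pose rS (S : seq (vertex Q)) := [rel u w | (w \in S) && from u w].
move=> H; have strong :
    {in flatten cs &, forall a b, connect (rS (flatten cs)) a b}.
  elim: H => [x|d {}cs x _ IH xcs cyc _] a b.
    by rewrite /= !inE => /eqP-> /eqP->.
  set S' := flatten (d :: cs).
  have xdS : all (mem S') (x :: d).
    apply/allP => y; rewrite inE /S' /= mem_cat => /orP[/eqP->|->] //.
    by rewrite xcs orbT.
  have cyc' : cycle (rS S') (x :: d).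
    by apply: (sub_in_cycle _ xdS cyc) => y z _ zS /= ->; rewrite andbT.
  have via c : c \in S' -> connect (rS S') c x /\ connect (rS S') x c.
    rewrite {1}/S' /= mem_cat => /orP[cd|ccs].
      by split; apply: (connect_cycle cyc'); rewrite inE ?eqxx ?cd ?orbT.
    have mono : subrel (connect (rS (flatten cs))) (connect (rS S')).
      apply: connect_sub => y z /= /andP[zS yz]; apply: connect1 => /=.
      by rewrite yz mem_cat zS orbT.
    by split; apply: mono; apply: IH.
  by move=> /via[ax _] /via[_ xb]; apply: connect_trans ax xb.
move=> a b aS bS; have /connectP[p pp ->] := strong a b aS bS.
case/shortenP: pp => p' pp' U _; exists p'; split=> //.
  by apply: sub_path pp' => y z /andP[].
elim: p' a pp' {aS U} => // y p' IH a /= /andP[/andP[yS _] /IH sp] z.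
by rewrite inE => /orP[/eqP->|/sp].
Qed.

(** A chord of an oriented cycle would be parallel to the arc of the cycle
    between its ends. *)
Lemma from_cycle_next C a b : uniq C -> cycle from C ->
  a \in C -> b \in C -> from a b -> b = next C a.
Proof.
move=> U cyc aC bC ab; have [i p E] := rot_to aC.
have Ur : uniq (rot i C) by rewrite rot_uniq.
rewrite -(next_rot i) //; move: cyc bC; rewrite -(rot_cycle i) -(mem_rot i).
move: Ur; rewrite E inE => Ur cyc /orP[/eqP ba|bp].
  by rewrite ba from_irr in ab.
case/splitPr: p / bp cyc Ur {E} => p1 p2 cyc Ur.
move: cyc Ur; rewrite /= -cat_rcons rcons_cat cat_path => /andP[pp _].
rewrite mem_cat cat_uniq negb_or => /andP[/andP[ap _] /andP[U1 _]].
have p10 : p1 = [::] by apply: (from_path_short ab pp); rewrite /= ap.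
by rewrite p10 /= eqxx.
Qed.

(** The arrows that touch a new ear are those of its cycle. By [from_cycle_next]
    it is enough that both ends are on the cycle. An arrow between the ear and
    an older vertex other than [x] would be parallel to the path that goes from
    one end to [x] and from there to the other end, one half running among the older
    vertices and the other one along the ear. *)
Lemma ear_next cs x d a b : ears cs -> x \in flatten cs ->
  cycle from (x :: d) -> uniq (d ++ flatten cs) ->
  a \in d ++ flatten cs -> b \in d ++ flatten cs -> (a \in d) || (b \in d) ->
  from a b -> [/\ a \in x :: d, b \in x :: d & b = next (x :: d) a].
Proof.
move=> H xS cyc; rewrite cat_uniq => /and3P[Ud dS US] aS' bS' abd ab.
have outS y : y \in d -> y \notin flatten cs.
  by move=> yd; apply: contra dS => yS; apply/hasP; exists y.
have Uxd : uniq (x :: d).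
  by rewrite /= Ud andbT; apply: contraL xS => /outS.
suff [ax bx] : a \in x :: d /\ b \in x :: d.
  by split=> //; apply: from_cycle_next.
have sep p s : {subset p <= flatten cs} -> {subset s <= d} -> ~~ has (mem p) s.
  by move=> pS sd; apply/hasPn => y /sd /outS; apply: contra => /pS.
rewrite !inE; split.
  have [->|ax] := eqVneq a x => //=; apply/negPn/negP => ad.
  have aS : a \in flatten cs by move: aS'; rewrite mem_cat (negPf ad).
  have bd : b \in d by rewrite (negPf ad) in abd.
  (* The path runs from a to x among the older vertices, then along the ear. *)
  have [p [pp lp Up pS]] := ears_connected H aS xS.
  case/splitPr: d / bd cyc Ud outS sep {dS aS' bS' abd Uxd} ad.
  move=> d1 d2 cyc Ud outS sep ad.
  move: cyc; rewrite /= -cat_rcons rcons_cat cat_path => /andP[pd _].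
  have: p ++ d1 = [::].
    apply: (from_path_short ab); rewrite rcons_cat.
      by rewrite cat_path pp lp.
    rewrite -cat_cons cat_uniq Up /=; move: Ud; rewrite -cat_rcons cat_uniq.
    case/andP=> -> _; rewrite andbT.
    apply: (sep (a :: p)); first by move=> y; rewrite inE => /orP[/eqP->|/pS].
    by move=> y yd; rewrite -cat_rcons mem_cat yd.
  by case: p lp {pp Up pS} => //= ax'; rewrite ax' eqxx in ax.
have [->|bx] := eqVneq b x => //=; apply/negPn/negP => bd.
have bS : b \in flatten cs by move: bS'; rewrite mem_cat (negPf bd).
have ad : a \in d by rewrite (negPf bd) orbF in abd.
(* The path runs along the ear from a to x, then among the older vertices. *)
have [p [pp lp Up pS]] := ears_connected H xS bS.
case/splitPr: d / ad cyc Ud outS sep {dS aS' bS' abd Uxd} bd.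
move=> d1 d2 cyc Ud outS sep bd.
move: cyc; rewrite /= rcons_cat cat_path => /andP[_ /= /andP[_ pd]].
case/lastP: p lp pp Up pS => [|p b'] /= lp pp Up pS.
  by rewrite lp eqxx in bx.
rewrite last_rcons in lp; subst b'.
suff: d2 ++ x :: p = [::] by case: (d2).
apply: (from_path_short ab); rewrite rcons_cat.
  by rewrite /= -cat_rcons cat_path pd last_rcons.
rewrite -cat_cons cat_uniq; move: Ud; rewrite cat_uniq => /and3P[_ _ ->].
rewrite [uniq (rcons (x :: p) b)]Up andbT has_sym.
apply: (sep (x :: rcons p b)).
  by move=> y; rewrite inE => /orP[/eqP->|/pS].
by move=> y yd; rewrite mem_cat yd orbT.
Qed.

(** A step from [a] to [b] that leaves the current vertices is prolonged by a
    path from [b] back to [a], cut at the first vertex [z] that is again one of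
    them. Distinct [a] and [z] would also be joined by a path
    among the current vertices, parallel to this one. *)
Lemma ears_extend cs y : irreducible Q -> ears cs -> y \notin flatten cs ->
  exists2 d, 0 < size d & ears (d :: cs).
Proof.
move=> irr H yS; have conn := irreducible_connect irr.
have [x xS] : exists x, x \in flatten cs.
  by case: (H) => [x|d cs' x _ xS _ _]; exists x;
    rewrite /= ?mem_cat ?inE ?xS ?orbT.
have /connectP[p0 pp0 lp0] := conn x y.
have [|a [b [aS bS ab]]] := path_exit pp0 xS; first by rewrite -lp0.
have [p [pp lp Up]] :
    exists p, [/\ path from b p, last b p = a & uniq (b :: p)].
  have /connectP[p' pp' ->] := conn b a.
  by case/shortenP: pp' => q qq Uq _; exists q.
have hp : has (mem (flatten cs)) p.
  apply/hasP; exists a => //; have: a \in b :: p by rewrite -lp mem_last.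
  by rewrite inE => /orP[/eqP E|//]; rewrite -E aS in bS.
case/split_find: hp pp Up {lp} => z p1 p2 zS hp1.
rewrite -cat_cons cat_uniq cat_path rcons_path => /andP[/andP[pp1 lz] _].
rewrite -rcons_cons rcons_uniq => /andP[/andP[zp Up] _].
have dS : ~~ has (mem (flatten cs)) (b :: p1) by rewrite /= negb_or bS.
exists (b :: p1) => //.
have Ud : uniq ((b :: p1) ++ flatten cs).
  by rewrite cat_uniq Up has_sym dS ears_uniq.
suff az : a = z.
  apply: (ears_glue (x := a)) => //.
  by rewrite /cycle rcons_path /= ab pp1 az.
apply/eqP/negPn/negP => az.
have [q [qq lq Uq qS]] := ears_connected H aS zS.
case/lastP: q lq qq Uq qS => [/= aE|q z']; first by rewrite aE eqxx in az.
rewrite last_rcons => -> qq Uq qS.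
suff: q ++ (b :: p1) = [::] by case: (q).
apply: (no_theta qq); first by rewrite rcons_path /= ab pp1.
have -> : uniq (a :: z :: q ++ b :: p1) = uniq ((a :: z :: q) ++ b :: p1) by [].
rewrite cat_uniq Up andbT; apply/andP; split.
  by move: Uq; rewrite /= rcons_uniq mem_rcons.
apply/hasPn => t td; apply: contra dS => tq; apply/hasP; exists t => //=.
move: tq; rewrite !inE => /or3P[/eqP->|/eqP->|tq] //.
by apply: qS; rewrite mem_rcons inE tq orbT.
Qed.

Lemma ears_cover : irreducible Q ->
  exists2 cs, ears cs & forall y, y \in flatten cs.
Proof.
move=> irr; suff grow n cs : #|vertex Q| - size (flatten cs) <= n -> ears cs ->
    exists2 cs, ears cs & forall y, y \in flatten cs.
  have /card_gt0P[x _] := quiver_nonempty Q.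
  exact: (grow _ [:: [:: x]] (leqnn _) (ears_root x)).
elim: n cs => [|n IH] cs szcs H.
  exists cs => // y; apply/negPn/negP => yS; move: szcs.
  rewrite leqn0 subn_eq0 leqNgt => /negP[].
  rewrite -(card_uniqP (ears_uniq H)); apply/proper_card/properP.
  by split; [apply/subsetP | exists y].
have [/forallP|] := boolP [forall y, y \in flatten cs]; first by exists cs.
rewrite negb_forall => /existsP[y yS].
have [d d0 Hd] := ears_extend irr H yS.
apply: (IH (d :: cs)) => //=; rewrite size_cat addnC subnDA leq_subLR.
by rewrite (leq_trans szcs) // -add1n leq_add2r.
Qed.

(** [ear_next] in terms of the positions along the ear. Its last vertex is
    followed on the cycle by [x], which is also the default value of [nth], so
    that [nth x d l.+1] is the successor of [nth x d l] even when [l] is the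
    last position. *)
Lemma ear_from cs x d : ears cs -> x \in flatten cs ->
  cycle from (x :: d) -> uniq (d ++ flatten cs) ->
  [/\ forall l m, l < size d -> m < size d ->
        from (nth x d l) (nth x d m) = (m == l.+1),
      forall l y, l < size d -> y \in flatten cs ->
        from (nth x d l) y = (y == x) && (l == (size d).-1) &
      forall l y, l < size d -> y \in flatten cs ->
        from y (nth x d l) = (y == x) && (l == 0)].
Proof.
move=> H xS cyc Uall; have := Uall.
rewrite cat_uniq => /and3P[Ud dS US].
have outS y : y \in d -> y \notin flatten cs.
  by move=> yd; apply: contra dS => yS; apply/hasP; exists y.
have xd : x \notin d by apply: contraL xS => /outS.
have Uxd : uniq (x :: d) by rewrite /= xd.
have nextE l : l <= size d -> next (x :: d) (nth x (x :: d) l) = nth x d l.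
  by move=> ls; rewrite next_nth mem_nth // index_uniq.
have fromE a b : a \in d ++ flatten cs -> b \in d ++ flatten cs ->
    (a \in d) || (b \in d) ->
    from a b = [&& a \in x :: d, b \in x :: d & b == next (x :: d) a].
  move=> aS bS abd; apply/idP/and3P => [ab|[ax _ /eqP->]].
    by have [-> -> <-] := ear_next H xS cyc Uall aS bS abd ab.
  exact: next_cycle cyc ax.
have inl y : y \in d -> y \in d ++ flatten cs by rewrite mem_cat => ->.
have inr y : y \in flatten cs -> y \in d ++ flatten cs.
  by rewrite mem_cat orbC => ->.
have xin y : y \in flatten cs -> (y \in x :: d) = (y == x).
  move=> yS; rewrite inE orbC.
  by case: (boolP (y \in d)) => // /outS; rewrite yS.
have wrap l : l < size d -> (x == nth x d l.+1) = (l == (size d).-1).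
  move=> ls; case: (ltngtP l.+1 (size d)) ls => // [ls _|ls _].
    rewrite (negPf (contraNneq _ xd)); last by move->; apply: mem_nth.
    by case: (size d) ls => //= n; rewrite ltnS => /ltn_eqF->.
  by rewrite nth_default ?ls // -ls !eqxx.
have nextS l : l < size d -> next (x :: d) (nth x d l) = nth x d l.+1.
  exact: (nextE l.+1).
split=> [l m ls ms|l y ls yS|l y ls yS].
- rewrite fromE ?inl ?mem_nth // !inE !mem_nth ?orbT // nextS //=.
  case: (ltngtP l.+1 (size d)) ls => // [ls _|ls _]; first by rewrite nth_uniq.
  rewrite (nth_default x (n := l.+1)) ?ls // ltn_eqF //.
  by apply/negbTE; apply: contraNneq xd => <-; apply: mem_nth.
- rewrite (fromE _ _ (inl _ (mem_nth x ls)) (inr _ yS)) ?mem_nth //.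
  rewrite (xin y) // inE mem_nth ?orbT // nextS //=.
  by case: eqP => [->|] //=; exact: wrap.
- rewrite (fromE _ _ (inr _ yS) (inl _ (mem_nth x ls))) ?mem_nth ?orbT //.
  rewrite (xin y) // inE mem_nth ?orbT //.
  case: eqP => [->|] //; have -> : next (x :: d) x = nth x d 0 := nextE 0 isT.
  by rewrite !andTb nth_uniq //; apply: leq_ltn_trans ls.
Qed.

(** The same description holds for the initial one-vertex chain, which has no
    older vertex. *)
Lemma newest_chain_from d cs : ears (d :: cs) -> exists x,
  [/\ forall l m, l < size d -> m < size d ->
        from (nth x d l) (nth x d m) = (m == l.+1),
      forall l y, l < size d -> y \in flatten cs ->
        from (nth x d l) y = (y == x) && (l == (size d).-1) &
      forall l y, l < size d -> y \in flatten cs ->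
        from y (nth x d l) = (y == x) && (l == 0)].
Proof.
move=> E; inversion E as [x|d' cs' x H xS cyc U]; last first.
  by exists x; apply: ear_from.
by exists x; split=> // -[|l] [|m] //; rewrite from_irr.
Qed.

(** * Labelling by the chains *)

Section Chains.
Variables (cs : seq (seq (vertex Q))) (H : ears cs).
Hypothesis cover : forall y, y \in flatten cs.

Definition chain_size (i : 'I_(size cs)) := size (nth [::] cs i).
Definition chain_vertex (i : 'I_(size cs)) (l : 'I_(chain_size i)) :=
  tnth (in_tuple (nth [::] cs i)) l.
Local Notation v := chain_vertex.
Local Notation older i := (flatten (drop i.+1 cs)).

Lemma chain_vertexE x i (l : 'I_(chain_size i)) : v l = nth x (nth [::] cs i) l.
Proof. exact: tnth_nth. Qed.

(** Forgetting the chains newer than a given one leaves an ear decomposition, so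
    that whatever holds for the newest chain holds for every chain. *)
Lemma ears_nth (i : 'I_(size cs)) : ears (nth [::] cs i :: drop i.+1 cs).
Proof. by rewrite -drop_nth //; apply: ears_drop. Qed.

Lemma older_mem (i j : 'I_(size cs)) (l : 'I_(chain_size j)) :
  i < j -> v l \in older i.
Proof.
move=> ij; apply/flattenP; exists (nth [::] cs j); last exact: mem_tnth.
rewrite -(subnKC ij) -nth_drop mem_nth // size_drop ltn_sub2r //.
exact: leq_ltn_trans ij _.
Qed.

Lemma chain_vertex_neq (i j : 'I_(size cs)) (l : 'I_(chain_size i))
  (m : 'I_(chain_size j)) : i < j -> v l != v m.
Proof.
move=> ij; have := ears_uniq (ears_nth i).
rewrite cat_uniq => /and3P[_ /hasPn dis _].
by apply: contraNneq (dis _ (older_mem m ij)) => <-; apply: mem_tnth.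
Qed.

Lemma chain_size_gt0 i : 0 < chain_size i.
Proof.
rewrite /chain_size; have := ears_nth i; case: (nth _ _ _) => // E.
by inversion E as [|d cs' x _ _ cyc]; rewrite /= from_irr in cyc.
Qed.

Lemma chain_labelling : labelling chain_vertex.
Proof.
have inj : injective (fun z : {i & 'I_(chain_size i)} => v (tagged z)).
  case=> [i l] [j m] /= E; have ij : i = j.
    apply/val_inj/eqP; case: ltngtP => // ij.
      by have := chain_vertex_neq l m ij; rewrite E eqxx.
    by have := chain_vertex_neq m l ij; rewrite E eqxx.
  case: j / ij m E => m E; congr existT.
  apply/val_inj/eqP; rewrite -(nth_uniq (v l) (ltn_ord l) (ltn_ord m)).
    by rewrite -!chain_vertexE E.
  by have := ears_uniq (ears_nth i); rewrite cat_uniq => /and3P[].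
have surj y : exists z : {i & 'I_(chain_size i)}, v (tagged z) == y.
  have /flattenP[d /(nthP [::])[i ics <-] /(nthP y)[l ls <-]] := cover y.
  exists (existT _ (Ordinal ics) (Ordinal (ls : l < chain_size (Ordinal ics)))).
  by rewrite (chain_vertexE y).
have K y : v (tagged (xchoose (surj y))) = y by apply/eqP/(xchooseP (surj y)).
by exists (fun y => xchoose (surj y)) => // z; apply: inj; rewrite K.
Qed.

Lemma chain_vertical : vertical_arrows chain_vertex.
Proof.
move=> i l m; have [x [inner _ _]] := newest_chain_from (ears_nth i).
by rewrite narrowsE !(chain_vertexE x) inner.
Qed.

Lemma chain_adj_sym : symmetric (chain_adj chain_vertex).
Proof.
by move=> i j; apply/existsP/existsP => -[l /existsP[m lm]]; exists m;
  apply/existsP; exists l; rewrite orbC.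
Qed.

(** The vertex [x] is where the ear [i] was glued; it accounts for all the
    arrows between this chain and the older ones. *)
Lemma chain_attach (i : 'I_(size cs)) : exists x,
  (forall j : 'I_(size cs), i < j -> chain_adj chain_vertex i j ->
    exists m : 'I_(chain_size j), v m = x) /\
  forall (j : 'I_(size cs)) (l : 'I_(chain_size i)) (m : 'I_(chain_size j)),
    i < j ->
    narrows (v l) (v m) = (v m == x) && (l == 0 :> nat) /\
    narrows (v m) (v l) = (v m == x) && (l == (chain_size i).-1 :> nat).
Proof.
have [x [_ down up]] := newest_chain_from (ears_nth i).
have att (j : 'I_(size cs)) (l : 'I_(chain_size i)) (m : 'I_(chain_size j)) :
    i < j ->
    narrows (v l) (v m) = (v m == x) && (l == 0 :> nat) /\
    narrows (v m) (v l) = (v m == x) && (l == (chain_size i).-1 :> nat).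
  move=> ij; rewrite !narrowsE (chain_vertexE x l) down ?up //;
    exact: older_mem.
exists x; split=> // j ij /existsP[l /existsP[m]].
by have [-> ->] := att j l m ij; case: eqP => // <- _; exists m.
Qed.

(** The oblique path goes from the first vertex of the ear to its attaching
    vertex and from there to the last vertex of the ear. *)
Lemma chain_oblique_older (i j : 'I_(size cs)) :
  i < j -> chain_adj chain_vertex i j -> oblique_path chain_vertex i j.
Proof.
move=> ij adj; have [x [/(_ j ij adj)[mx mxE] att]] := chain_attach i.
have i0 := chain_size_gt0 i.
have imax : (chain_size i).-1 < chain_size i by rewrite prednK.
pose first := Ordinal i0; pose final := Ordinal imax.
(* A one-vertex ear would form a 2-cycle with x. *)
have size_gt1 : 0 < (chain_size i).-1.
  rewrite lt0n; apply/negP => /eqP size1; have [] := att j first mx ij.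
  rewrite !narrowsE mxE size1 !eqxx /=.
  by case: (boolP (from x (v first))) => // /from_asym ->.
have vj (m : 'I_(chain_size j)) : (v m == x) = (m == mx).
  rewrite -mxE !(chain_vertexE x) nth_uniq //.
  by have := ears_uniq (ears_nth j); rewrite cat_uniq => /and3P[].
exists [:: first; final], [:: mx]; split=> //; first by rewrite /= size_gt1.
  by right.
move=> l m; have [-> ->] := att j l m ij.
by rewrite !inE !xpair_eqE vj andbC.
Qed.

Lemma chain_oblique : oblique_arrows chain_vertex.
Proof.
move=> i j; rewrite neq_ltn => /orP[ij|ji] adj.
  by left; apply: chain_oblique_older.
by right; apply: chain_oblique_older; rewrite // chain_adj_sym.
Qed.

Lemma chain_adj_older_uniq (i j k : 'I_(size cs)) : i < j -> i < k ->
  chain_adj chain_vertex i j -> chain_adj chain_vertex i k -> j = k.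
Proof.
move=> ij ik; have [x [att _]] := chain_attach i.
move=> /(att j ij)[m mx] /(att k ik)[m' m'x].
apply/val_inj/eqP; case: ltngtP => // jk.
  by have := chain_vertex_neq m m' jk; rewrite mx m'x eqxx.
by have := chain_vertex_neq m' m jk; rewrite mx m'x eqxx.
Qed.

(** The newest chain of a cycle of chains, which has the smallest index, would
    be adjacent to two different older chains, its neighbours on the cycle. *)
Lemma chain_forest : no_chain_cycle chain_vertex.
Proof.
move=> i1 s /andP[s3 _] U pth; apply/negP => closing.
have cyc : cycle (chain_adj chain_vertex) (i1 :: s).
  by rewrite /= rcons_path pth chain_adj_sym.
have [i ic imin] := @arg_minnP _ i1 (mem (i1 :: s)) val (mem_head _ _).
have [n t E] := rot_to ic.
have older_t j : j \in t -> i < j.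
  move=> jt; have Ut : uniq (i :: t) by rewrite -E rot_uniq.
  case/andP: Ut => it _; rewrite ltn_neqAle imin.
    by rewrite andbT; apply: contraNneq it => /val_inj->.
  by rewrite -[mem _ _]/(j \in i1 :: s) -(mem_rot n) E inE jt orbT.
have : 2 < size (i :: t) by rewrite -E size_rot.
have : uniq (i :: t) by rewrite -E rot_uniq.
have : cycle (chain_adj chain_vertex) (i :: t) by rewrite -E rot_cycle.
case: t {E} older_t => // j t; case/lastP: t => // t k older_t.
rewrite /= !rcons_path last_rcons => /andP[ij /andP[_ ki]].
have <- : j = k.
  by apply: (chain_adj_older_uniq (i := i)) => //; rewrite 1?chain_adj_sym //;
    apply: older_t; rewrite ?mem_head // inE mem_rcons mem_head orbT.
by rewrite mem_rcons mem_head /= andbF.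
Qed.

End Chains.
End Paths.

Theorem proposition4p8 (Q : quiver) (irrQ : irreducible Q)
    (cycQ : forall c : seq (step Q), is_cycle c -> oriented c) :
  exists N : nat, 1 <= N /\ QN_quiver N Q.
Proof.
have [cs H cover] := ears_cover cycQ irrQ.
exists (size cs); split; first by case: H.
exists (@chain_size Q cs), (@chain_vertex Q cs); split.
  by move=> i; apply: chain_size_gt0.
split; [exact: chain_labelling | exact: chain_vertical | exact: chain_oblique |
  exact: chain_forest].
Qed.
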